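(* Let $n=1$ or $n=3$, and let $\langle-,-\rangle$ be the Euclidean metric of $\mathbb{R}^{2n+1}$. Let $J$ be any almost complex structure on the unit sphere $S^{2n}\subset\mathbb{R}^{2n+1}$, equipped with the induced metric and its Levi-Civita connection $\nabla$. Let $P:S^{2n}\to\mathcal{I}_{n+1,2n+1}$ be the canonical map induced by $J$. Then the pullback along $P$ of the real part of the $2$-form $\omega$ on $\mathcal{I}_{n+1,2n+1}$ is given by $$P^*\operatorname{Re}(\omega)(X,Y)=-\tfrac18\operatorname{Im}\operatorname{Tr}\Big([\nabla_XJ,\nabla_YJ]\big|_{T^{0,1}}\Big)-\tfrac14\langle X,JY\rangle+\tfrac14\langle Y,JX\rangle$$ for all tangent vectors $X,Y$ at a common point of $S^{2n}$.
   Context: An almost complex structure on a manifold $M$ is a smooth section $J$ of $\operatorname{End}(TM)$ with $J^2=-\operatorname{Id}$. $(\nabla_X J)Y=\nabla_X(JY)-J\nabla_XY$. $T^{1,0}_x$ and $T^{0,1}_x$ are the $+i$ and $-i$ eigenspaces of $J$ on $T_xM\otimes\mathbb{C}$. $\mathcal{I}_{k,N}=\{P\in M_{N\times N}(\mathbb{C}): P^2=P,\ \operatorname{rank}P=k\}$, a smooth manifold with $T_P\mathcal{I}_{k,N}=\{A\in M_{N\times N}(\mathbb{C}): AP=(I-P)A,\ PA=A(I-P)\}$. The closed complex-valued $2$-form $\omega=\frac1{2i}\operatorname{Tr}(P\,dP^2)$ on $\mathcal{I}_{k,N}$ is given concretely by $\omega(A,B)=\frac1{2i}\operatorname{Tr}(PAB-PBA)$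 for $A,B\in T_P\mathcal{I}_{k,N}$. The canonical map $P:S^{2n}\to\mathcal{I}_{n+1,2n+1}$ sends $x$ to the unique projection on $\mathbb{C}^{2n+1}=\big(T^{0,1}_x\oplus(N_x\otimes\mathbb{C})\big)\oplus T^{1,0}_x$ with image $T^{0,1}_x\oplus(N_x\otimes\mathbb{C})$ and kernel $T^{1,0}_x$, where $N_x$ is the Euclidean normal line to $S^{2n}$ at $x$. The commutator $[\nabla_XJ,\nabla_YJ]$ (extended $\mathbb{C}$-linearly) commutes with $J$, hence preserves $T^{0,1}$; $[\nabla_XJ,\nabla_YJ]|_{T^{0,1}}:T^{0,1}\to T^{0,1}$ is its restriction and $\operatorname{Tr}$ is the complex trace. *)

(* Defs.v *)
From HB Require Import structures.
From mathcomp Require Import all_boot all_order all_algebra.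
From mathcomp Require Import all_classical all_reals all_analysis.
From mathcomp Require Import complex.

Set Implicit Arguments.
Unset Strict Implicit.
Unset Printing Implicit Defensive.
Import Order.TTheory GRing.Theory Num.Theory.
Import numFieldNormedType.Exports.

Local Open Scope classical_set_scope.
Local Open Scope ring_scope.

Section Sphere.
Context {R : realType}.

Definition dot N (u v : 'cV[R]_N) : R := \sum_i u i 0 * v i 0.

(* The unit sphere S^n in R^(n+1). *)
Definition sphere n := {x : 'cV[R]_n.+1 | dot x x == 1}.

Context {n : nat}.
Local Notation V := ('cV[R]_n.+1).
Local Notation S := (sphere n).

Definition tangent (x : S) (v : V) : Prop := dot (val x) v = 0.

Fixpoint Ck (k : nat) (U : set V) (g : V -> R) : Prop :=
  match k with
  | 0 => forall y, U y -> {for y, continuous g}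
  | k'.+1 => (forall y, U y -> differentiable g y) /\
             (forall v, Ck k' U (fun y => 'D_v g y))
  end.

Definition smooth (f : S -> R) : Prop :=
  forall x : S, exists (U : set V) (g : V -> R),
    [/\ open U, U (val x), forall k, Ck k U g &
        forall y : S, U (val y) -> f y = g (val y)].

(* The radial retraction y |-> y / |y|, with default value x at y = 0. *)
Definition retract (x : S) (y : V) : S :=
  insubd x ((Num.sqrt (dot y y))^-1 *: y).

(* The differential of f at x applied to a tangent vector v, computed along the
   curve t |-> (x + t v) / |x + t v|, which has velocity v at t = 0. *)
Definition sdiff (f : S -> R) (x : S) (v : V) : R :=
  'D_v (f \o retract x) (val x).

Definition vector_field (Y : S -> V) : Prop :=
  (forall x, tangent x (Y x)) /\ (forall i, smooth (fun x => Y x i 0)).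

(* A linear connection, as the map (x, v, Y) |-> (nabla_v Y)(x) for v tangent at
   x and Y a vector field; its values on other arguments are irrelevant. *)
Definition connection := forall x : S, V -> (S -> V) -> V.

Definition is_connection (nabla : connection) : Prop :=
  [/\ forall X Y, vector_field X -> vector_field Y ->
        vector_field (fun x => nabla x (X x) Y),
      forall x (a : R) u v Y, tangent x u -> tangent x v -> vector_field Y ->
        nabla x (a *: u + v) Y = a *: nabla x u Y + nabla x v Y,
      forall x v Y Z, tangent x v -> vector_field Y -> vector_field Z ->
        nabla x v (fun y => Y y + Z y) = nabla x v Y + nabla x v Z &
      forall x v f Y, tangent x v -> smooth f -> vector_field Y ->
        nabla x v (fun y => f y *: Y y) =
          f x *: nabla x v Y + sdiff f x v *: Y x].

Definition metric_compatible (nabla : connection) : Prop :=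
  forall x v Y Z, tangent x v -> vector_field Y -> vector_field Z ->
    sdiff (fun y => dot (Y y) (Z y)) x v =
      dot (nabla x v Y) (Z x) + dot (Y x) (nabla x v Z).

(* nabla_X Y - nabla_Y X = [X, Y], as derivations of smooth functions. *)
Definition torsion_free (nabla : connection) : Prop :=
  forall X Y f x, vector_field X -> vector_field Y -> smooth f ->
    sdiff f x (nabla x (X x) Y - nabla x (Y x) X) =
      sdiff (fun y => sdiff f y (Y y)) x (X x) -
      sdiff (fun y => sdiff f y (X y)) x (Y x).

Definition levi_civita (nabla : connection) : Prop :=
  [/\ is_connection nabla, metric_compatible nabla & torsion_free nabla].

(* A section of End(TS) is represented by matrices acting on columns: the
   endomorphism of the tangent space at x is extended by 0 on the normal line
   at x.  This identifies End(TS) with a smooth subbundle of S x M_(n+1)(R), so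
   that a section is smooth iff its matrix entries are. *)
Definition almost_complex (J : S -> 'M[R]_n.+1) : Prop :=
  [/\ forall i j, smooth (fun x => J x i j),
      forall x, J x *m val x = 0,
      forall x v, tangent x v -> tangent x (J x *m v) &
      forall x v, tangent x v -> J x *m (J x *m v) = - v].

(* (nabla_v J) Y at the point x. *)
Definition nablaJ (nabla : connection) (J : S -> 'M[R]_n.+1) (x : S) (v : V)
    (Y : S -> V) : V :=
  nabla x v (fun y => J y *m Y y) - J x *m nabla x v Y.

Definition tangent_part (w : V) (y : S) : V := w - dot (val y) w *: val y.

(* The matrix of the endomorphism nabla_v J of the tangent space at x, extended
   by 0 on the normal line (see nablaJ_tensorial): column j is obtained from the
   field of tangential projections of the j-th basis vector. *)
Definition nablaJ_mx nabla J (x : S) (v : V) : 'M[R]_n.+1 :=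
  \matrix_(i, j) nablaJ nabla J x v (tangent_part (delta_mx j 0)) i 0.

Local Notation C := (R[i]).

Definition toC p q (A : 'M[R]_(p, q)) : 'M[C]_(p, q) :=
  map_mx (real_complex R) A.

(* Subspaces of C^(n+1) are row spaces of matrices, whence the transposes: a
   column v lies in the subspace W iff (v^T <= W)%MS.  As J x kills the normal
   line, its eigenspaces on C^(n+1) for 'i and - 'i lie in the complexified
   tangent space. *)
Definition T10 (J : S -> 'M[R]_n.+1) (x : S) : 'M[C]_n.+1 :=
  eigenspace (toC (J x))^T 'i%C.
Definition T01 (J : S -> 'M[R]_n.+1) (x : S) : 'M[C]_n.+1 :=
  eigenspace (toC (J x))^T (- 'i%C).
Definition normal_lineC (x : S) : 'M[C]_n.+1 := <<(toC (val x))^T>>%MS.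

(* The projection with image T01 + N (x) C and kernel T10. *)
Definition canonical_map (J : S -> 'M[R]_n.+1) (x : S) : 'M[C]_n.+1 :=
  (proj_mx (T01 J x + normal_lineC x)%MS (T10 J x))^T.

Definition sdiff_mx p q (F : S -> 'M[C]_(p, q)) (x : S) (v : V) : 'M[C]_(p, q) :=
  \matrix_(i, j) Complex (sdiff (fun y => complex.Re (F y i j)) x v)
                         (sdiff (fun y => complex.Im (F y i j)) x v).

Definition pullback p q T (F : S -> 'M[C]_(p, q))
    (eta : 'M[C]_(p, q) -> 'M[C]_(p, q) -> 'M[C]_(p, q) -> T) (x : S) (u v : V) : T :=
  eta (F x) (sdiff_mx F x u) (sdiff_mx F x v).

(* Trace of the restriction of A (acting on columns) to an A-invariant W. *)
Definition trace_on N (W A : 'M[C]_N) : C := \tr (restrictmx W A^T).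

End Sphere.

Arguments sphere R n : clear implicits.
Arguments connection R n : clear implicits.

(* I_(k,N), the idempotent N x N matrices of rank k. *)
Definition idempotents (F : fieldType) (k N : nat) (P : 'M[F]_N) : Prop :=
  P *m P = P /\ \rank P = k.

(* The 2-form (1/2i) Tr(P dP^2) on I_(k,N), at P and on tangent vectors A, B. *)
Definition omega (R : realType) N (P A B : 'M[R[i]]_N) : R[i] :=
  (2%:R * 'i%C)^-1 * \tr (P *m A *m B - P *m B *m A).

Definition Re_omega (R : realType) N (P A B : 'M[R[i]]_N) : R :=
  complex.Re (omega P A B).

Lemma tr_mul_dot (R : realType) N (u v : 'cV[R]_N) : u^T *m v = (dot u v)%:M.
Proof.
apply/matrixP => i j; rewrite !mxE !ord1 eqxx mulr1n.
by apply: eq_bigr => k _; rewrite mxE.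
Qed.

Lemma sqr_almost_complex (R : realType) n (J : sphere R n -> 'M[R]_n.+1)
    (x : sphere R n) :
  almost_complex J -> 1%:M + J x *m J x = val x *m (val x)^T.
Proof.
move=> [_ J0 Jt J2]; set s := val x.
have H (w : 'cV[R]_n.+1) : (1%:M + J x *m J x) *m w = s *m s^T *m w.
  have E : w = (w - dot s w *: s) + dot s w *: s by rewrite subrK.
  have tw : tangent x (w - dot s w *: s).
    rewrite /tangent; apply/eqP.
    have := tr_mul_dot s (w - dot s w *: s).
    rewrite mulmxBr -scalemxAr !tr_mul_dot (eqP (valP x)) scale_scalar_mx mulr1 subrr.
    by move/matrixP/(_ 0 0); rewrite !mxE eqxx mulr1n => <-.
  rewrite mulmxDl mul1mx -!mulmxA tr_mul_dot mul_mx_scalar {2}E mulmxDr.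
  rewrite -scalemxAr J0 scaler0 addr0 J2 //.
  by rewrite opprB addrC subrK.
apply/matrixP => i j.
by have := H (delta_mx j 0); rewrite -!colE => /matrixP/(_ i 0); rewrite ![col _ _ _ _]mxE.
Qed.

Section Canonical.
Context {R : realType} {n : nat}.
Context (J : sphere R n -> 'M[R]_n.+1) (x : sphere R n) (hJ : almost_complex J).
Local Notation C := R[i].
Local Notation A := (toC (J x))^T.
Local Notation i := ('i%C : C).

Lemma sqr_toC : 1%:M + A *m A = (toC (val x)) *m (toC (val x))^T.
Proof.
have /(congr1 (fun B => (toC B)^T)) := sqr_almost_complex x hJ.
rewrite /toC map_mxD map_mx1 !map_mxM linearD /= trmx1 !trmx_mul -!map_trmx trmxK.
by [].
Qed.

Lemma normal_kill m (u : 'M[C]_(m, n.+1)) : (u <= normal_lineC x)%MS -> u *m A = 0.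
Proof.
rewrite /normal_lineC genmxE => /submxP [D ->].
rewrite -mulmxA -trmx_mul /toC -map_mxM; case: hJ => _ -> _ _.
by rewrite map_mx0 trmx0 mulmx0.
Qed.

Lemma i2 : i * i = -1.
Proof.
by apply/eqP; rewrite eq_complex /= !mul0r !mulr0 mulr1 sub0r addr0 oppr0 !eqxx.
Qed.

Lemma i_neq0 : i != 0.
Proof. by rewrite eq_complex /= oner_eq0 andbF. Qed.

Lemma canonical_disjoint : ((T01 J x + normal_lineC x) :&: T10 J x)%MS = 0.
Proof.
apply/eqP/rowV0P => u; rewrite sub_capmx => /andP [/sub_addsmxP [[a b] /= ->]].
set a' := a *m _; set b' := b *m _.
have ha : a' *m A = - i *: a' by apply/eigenspaceP; exact: submxMl.
have hb : b' *m A = 0 by apply: normal_kill; exact: submxMl.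
move=> /eigenspaceP; rewrite mulmxDl ha hb addr0 => E.
have E2 : b' = - (2%:R *: a').
  apply: (scalerI i_neq0).
  have -> : i *: b' = i *: (a' + b') - i *: a' by rewrite scalerDr [_ + i *: b']addrC addrK.
  by rewrite -E scalerN scalerA mulr_natr mulr2n scalerDl opprD scaleNr.
have a0 : a' = 0.
  have := hb; rewrite E2 mulNmx -scalemxAl ha scalerA => /eqP.
  rewrite oppr_eq0 scaler_eq0 mulf_eq0 oppr_eq0 (negPf i_neq0) orbF.
  by rewrite pnatr_eq0 /= => /eqP.
by rewrite E2 a0 scaler0 oppr0 addr0.
Qed.

Lemma canonical_full : (1%:M <= (T01 J x + normal_lineC x) + T10 J x)%MS.
Proof.
have AN : (1%:M + A *m A) *m A = 0.
  apply: normal_kill; rewrite sqr_toC /normal_lineC genmxE; exact: submxMl.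
have A3 : A *m A *m A = - A.
  by apply/eqP; rewrite -addr_eq0 addrC; move: AN; rewrite mulmxDl mul1mx => ->.
pose h : C := 2%:R^-1.
have hh : h + h = 1 by rewrite -mulr2n -[h]mulr1 -mulrnAr mulVf ?pnatr_eq0.
pose a := h *: (i *: A - A *m A); pose b := h *: (- i *: A - A *m A).
have -> : 1%:M = (a + (1%:M + A *m A)) + b.
  rewrite addrAC -scalerDr addrACA scaleNr subrr add0r -mulr2n -scaler_nat scalerA.
  by rewrite /h mulVf ?pnatr_eq0 // scale1r addrC addrK.
apply: addmx_sub_adds; first apply: addmx_sub_adds.
- apply/eigenspaceP; rewrite /a -scalemxAl mulmxBl -scalemxAl A3 opprK.
  rewrite scalerA mulrC -scalerA scalerBr scalerA mulNr i2 opprK scale1r scaleNr opprK.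
  by rewrite addrC.
- by rewrite sqr_toC /normal_lineC genmxE; exact: submxMl.
- apply/eigenspaceP; rewrite /b -scalemxAl mulmxBl -scalemxAl A3 opprK.
  rewrite scalerA [X in _ = X *: _]mulrC -scalerA scalerBr scalerA mulrN i2 opprK scale1r scaleNr.
  by rewrite addrC.
Qed.

Lemma rank_T : \rank (T01 J x) = \rank (T10 J x).
Proof.
rewrite /T01 /T10 /eigenspace !mxrank_ker; congr (_ - _)%N.
rewrite -[RHS](mxrank_map (@conjc R)) map_mxB map_scalar_mx /=.
congr (\rank (_ - _%:M)); first by apply/matrixP => k l; rewrite !mxE /= oppr0.
by apply/eqP; rewrite eq_complex /= oppr0 !eqxx.
Qed.

Lemma rank_normal_lineC : \rank (normal_lineC x) = 1%N.
Proof.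
rewrite /normal_lineC mxrank_gen rank_rV; case: eqP => // E; exfalso.
have := tr_mul_dot (val x) (val x); rewrite (eqP (valP x)) => /(congr1 (@toC R 1 1)).
rewrite /toC map_mxM -map_trmx; rewrite /toC in E; rewrite E mul0mx map_scalar_mx.
by move=> /matrixP/(_ 0 0)/eqP; rewrite !mxE eqxx mulr1n eq_sym fmorph_eq0 oner_eq0.
Qed.

End Canonical.

(* The canonical map takes its values in I_(n+1,2n+1). *)
Lemma canonical_map_idempotents (R : realType) (n : nat)
    (J : sphere R n.*2 -> 'M[R]_n.*2.+1) (x : sphere R n.*2) :
  almost_complex J -> idempotents n.+1 (canonical_map J x).
Proof.
move=> hJ; split.
  by rewrite /canonical_map -trmx_mul proj_mx_proj //; exact: canonical_disjoint.
have D := canonical_disjoint x hJ.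
have W : \rank (T01 J x + normal_lineC x)%MS = (\rank (T01 J x)).+1.
  rewrite mxrank_disjoint_sum ?rank_normal_lineC ?addn1 //.
  apply/eqP/rowV0P => u; rewrite sub_capmx => /andP [/eigenspaceP h /(normal_kill hJ)].
  by rewrite h => /eqP; rewrite scaler_eq0 oppr_eq0 (negPf i_neq0) => /eqP.
have F : (\rank (T01 J x + normal_lineC x)%MS + \rank (T10 J x) = n.*2.+1)%N.
  rewrite -(mxrank_disjoint_sum D); apply/eqP.
  by rewrite -/(row_full _) -sub1mx canonical_full.
rewrite /canonical_map mxrank_tr.
have -> : \rank (proj_mx (T01 J x + normal_lineC x)%MS (T10 J x)) =
    \rank (T01 J x + normal_lineC x)%MS.
  apply/eqP; rewrite eqn_leq; apply/andP; split; apply: mxrankS.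
    by rewrite -[X in (X <= _)%MS]mul1mx proj_mx_sub.
  by rewrite -[X in (X <= _)%MS](proj_mx_id D (submx_refl _)) submxMl.
have arith (a b c m : nat) : a = b.+1 -> b = c -> (a + c = m.*2.+1)%N -> a = m.+1.
  by move=> -> -> ; rewrite addSn addnn => /succn_inj/double_inj ->.
exact: arith W (rank_T J x) F.
Qed.

Section Smooth.
Context {R : realType} {n : nat}.
Local Notation V := ('cV[R]_n.+1).
Local Notation S := (sphere R n).
Implicit Types (U : set V) (g h : V -> R).

Lemma Ck_sub k U U' g : (U' `<=` U)%classic -> Ck k U g -> Ck k U' g.
Proof.
move=> sU; elim: k g => [|k IH] g /=; first by move=> H y /sU/H.
by move=> [H1 H2]; split=> [y /sU/H1//|v]; apply: IH.
Qed.

Lemma near_eq_differentiable g h y : {near nbhs y, g =1 h} ->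
  differentiable g y -> differentiable h y.
Proof.
move=> E dg; have -> : h = g + (h - g) by rewrite addrC subrK.
apply: differentiableD => //.
have d0 : (h - g) y = 0 by rewrite !fctE (nbhs_singleton E) subrr.
have : continuous (0 : V -> R) /\ (h - g) \o shift y = cst ((h - g) y) + (\0 : V -> R) +o_ 0 id.
  split; first exact: cst_continuous.
  apply/eqaddoE; rewrite addr0 funeqE d0 => z /=; rewrite add0r littleoE //.
  move=> e e0; rewrite [\forall x \near _, _ <= _](near_shift y); near=> w.
  rewrite /= sub0r subrK !fctE.
  have -> : g w = h w by near: w.
  by rewrite subrr normr0 mulr_ge0 // ltW.
move=> [c H]; have D := diff_unique c H.
by apply/diff_locallyP; rewrite D.
Unshelve. all: by end_near. Qed.

Lemma Ck_ext k U g h : open U -> (forall y, U y -> g y = h y) ->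
  Ck k U g -> Ck k U h.
Proof.
move=> oU.
have N (g' h' : V -> R) y : (forall y, U y -> g' y = h' y) -> U y ->
    \forall z \near y, g' z = h' z.
  by move=> E Uy; apply: filterS E _; exact: open_nbhs_nbhs.
elim: k g h => [|k IH] g h E /=.
  move=> H y Uy; have := H y Uy; rewrite /prop_for /continuous_at -(E y Uy) => C.
  by apply: cvg_trans C; apply: (@near_eq_cvg _ _ (nbhs y) _ g h); exact: (N g h y E Uy).
move=> [H1 H2]; split=> [y Uy|v].
  by apply: near_eq_differentiable (H1 y Uy); apply: N.
by apply: IH (H2 v) => y Uy; apply: near_eq_derive; apply: N.
Qed.

Lemma CkW k U g : Ck k.+1 U g -> Ck k U g.
Proof.
elim: k g => [|k IH] g [H1 H2].
  by move=> y Uy; apply: differentiable_continuous; exact: H1.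
by split=> // v; apply: IH; exact: H2.
Qed.

Lemma Ck_cst k U c : Ck k U (fun=> c).
Proof.
elim: k c => [|k IH] c /=; first by move=> y _; exact: cst_continuous.
by split=> [y _|v]; [exact: differentiable_cst|under eq_fun do rewrite derive_cst; exact: IH].
Qed.

Lemma Ck_coord k U i : Ck k U (fun y => y i 0).
Proof.
case: k => [|k] /=; first by move=> y _; exact: coord_continuous.
have D y : differentiable (fun z : V => z i 0) y by exact: differentiable_coord.
split=> [y _ //|v]; under eq_fun => y do rewrite deriveE //.
have L y : 'd (fun z : V => z i 0) y v = v i 0.
  have @f : {linear V -> R}.
    by exists (fun N : V => N i 0); do 2![eexists]; do ?[constructor];
       rewrite ?mxE// => ? *; rewrite ?mxE//; move=> ?; rewrite !mxE.
  rewrite (_ : (fun _ => _) = f) // diff_lin //; exact: coord_continuous.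
by under eq_fun do rewrite L; exact: Ck_cst.
Qed.

Lemma CkD k U g h : open U -> Ck k U g -> Ck k U h -> Ck k U (fun y => g y + h y).
Proof.
move=> oU; elim: k g h => [|k IH] g h /=.
  by move=> Hg Hh y Uy; apply: continuousD; [exact: Hg|exact: Hh].
move=> [Hg1 Hg2] [Hh1 Hh2]; split=> [y Uy|v].
  by apply: differentiableD; [exact: Hg1|exact: Hh1].
apply: Ck_ext (IH _ _ (Hg2 v) (Hh2 v)) => // y Uy.
by rewrite -deriveD //; apply: diff_derivable; [exact: Hg1|exact: Hh1].
Qed.

Lemma CkM k U g h : open U -> Ck k U g -> Ck k U h -> Ck k U (fun y => g y * h y).
Proof.
move=> oU; elim: k g h => [|k IH] g h /=.
  by move=> Hg Hh y Uy; apply: continuousM; [exact: Hg|exact: Hh].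
move=> Hg Hh; have [Hg1 Hg2] := Hg; have [Hh1 Hh2] := Hh; split=> [y Uy|v].
  by apply: differentiableM; [exact: Hg1|exact: Hh1].
apply: Ck_ext (CkD oU (IH _ _ (CkW Hg) (Hh2 v)) (IH _ _ (CkW Hh) (Hg2 v))) => // y Uy.
by rewrite deriveM //; apply: diff_derivable; [exact: Hg1|exact: Hh1].
Qed.

Lemma smooth_op (op : R -> R -> R) (f1 f2 : S -> R) :
  (forall k U g h, open U -> Ck k U g -> Ck k U h -> Ck k U (fun y => op (g y) (h y))) ->
  smooth f1 -> smooth f2 -> smooth (fun x => op (f1 x) (f2 x)).
Proof.
move=> H s1 s2 x; have [U1 [g1 [q1 x1 c1 e1]]] := s1 x.
have [U2 [g2 [q2 x2 c2 e2]]] := s2 x.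
exists (U1 `&` U2)%classic, (fun y => op (g1 y) (g2 y)); split.
- exact: openI.
- by [].
- move=> k; apply: H; first exact: openI.
    by apply: Ck_sub (c1 k) => ? [].
  by apply: Ck_sub (c2 k) => ? [].
- by move=> y [u1 u2]; rewrite e1 // e2.
Qed.

Lemma smoothD (f1 f2 : S -> R) : smooth f1 -> smooth f2 -> smooth (fun x => f1 x + f2 x).
Proof. by apply: (@smooth_op +%R); exact: CkD. Qed.
Lemma smoothM (f1 f2 : S -> R) : smooth f1 -> smooth f2 -> smooth (fun x => f1 x * f2 x).
Proof. by apply: (@smooth_op *%R); exact: CkM. Qed.

Lemma smooth_cst c : smooth (fun _ : S => c).
Proof. by move=> x; exists setT, (fun=> c); split=> // [|k]; [exact: openT|exact: Ck_cst]. Qed.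
Lemma smooth_coord i : smooth (fun x : S => val x i 0).
Proof.
by move=> x; exists setT, (fun y => y i 0); split=> // [|k]; [exact: openT|exact: Ck_coord].
Qed.

Lemma smooth_sum I (r : seq I) (F : I -> S -> R) : (forall i, smooth (F i)) ->
  smooth (fun x => \sum_(i <- r) F i x).
Proof.
move=> H; elim: r => [|i r IH].
  by under eq_fun do rewrite big_nil; exact: smooth_cst.
by under eq_fun do rewrite big_cons; exact: smoothD.
Qed.

Lemma dotE N (u v : 'cV[R]_N) : dot u v = (u^T *m v) 0 0.
Proof. by rewrite tr_mul_dot mxE eqxx mulr1n. Qed.

Lemma vf_tangent_part w : vector_field (tangent_part w : S -> V).
Proof.
split=> [x|i].
  rewrite /tangent dotE mulmxBr -scalemxAr !tr_mul_dot (eqP (valP x)).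
  by rewrite !mxE eqxx !mulr1n mulr1 subrr.
rewrite /tangent_part; under eq_fun do rewrite !mxE -mulNr.
apply: smoothD; first exact: smooth_cst.
apply: smoothM; last exact: smooth_coord.
under eq_fun do rewrite -mulN1r; apply: smoothM; first exact: smooth_cst.
by apply: smooth_sum => j; apply: smoothM; [exact: smooth_coord|exact: smooth_cst].
Qed.

Lemma vfJ (J : S -> 'M[R]_n.+1) Y : almost_complex J -> vector_field Y ->
  vector_field (fun y => J y *m Y y).
Proof.
move=> [Js _ Jt _] [Yt Ys]; split=> [x|i]; first exact: Jt.
by under eq_fun do rewrite mxE; apply: smooth_sum => j; exact: smoothM.
Qed.

Lemma vfZ f Y : smooth f -> vector_field Y -> vector_field (fun y : S => f y *: Y y).
Proof.
move=> fs [Yt Ys]; split=> [x|i]; last by under eq_fun do rewrite mxE; exact: smoothM.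
by rewrite /tangent dotE -scalemxAr mxE -dotE Yt mulr0.
Qed.

Lemma vf0 : vector_field (fun _ : S => 0).
Proof.
by split=> [x|i]; [rewrite /tangent dotE mulmx0 mxE|under eq_fun do rewrite mxE; exact: smooth_cst].
Qed.

Lemma vfD Y Z : vector_field Y -> vector_field Z -> vector_field (fun y : S => Y y + Z y).
Proof.
move=> [Yt Ys] [Zt Zs]; split=> [x|i].
  by rewrite /tangent dotE mulmxDr mxE -!dotE Yt Zt addr0.
by under eq_fun do rewrite mxE; exact: smoothD.
Qed.

Lemma vf_sum I (r : seq I) (F : I -> S -> V) : (forall i, vector_field (F i)) ->
  vector_field (fun x => \sum_(i <- r) F i x).
Proof.
move=> H; elim: r => [|i r IH].
  by under eq_fun do rewrite big_nil; exact: vf0.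
by under eq_fun do rewrite big_cons; exact: vfD.
Qed.

(* (nabla_v J) Y at x only depends on Y x, through the matrix nablaJ_mx. *)
Lemma nablaJ_tensorial (nabla : connection R n) (J : S -> 'M[R]_n.+1) x v Y :
  is_connection nabla -> almost_complex J -> tangent x v -> vector_field Y ->
  nablaJ_mx nabla J x v *m Y x = nablaJ nabla J x v Y.
Proof.
move=> [_ _ nD nZ] hJ tv vY.
pose E j : S -> V := tangent_part (delta_mx j 0).
have vE j : vector_field (E j) by exact: vf_tangent_part.
have JD A B : vector_field A -> vector_field B ->
    nablaJ nabla J x v (fun y => A y + B y) = nablaJ nabla J x v A + nablaJ nabla J x v B.
  move=> vA vB; rewrite /nablaJ; under eq_fun do rewrite mulmxDr.
  have vJA := vfJ hJ vA; have vJB := vfJ hJ vB.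
  by rewrite (nD x v _ _ tv vJA vJB) (nD x v _ _ tv vA vB) mulmxDr opprD addrACA.
have JZ f B : smooth f -> vector_field B ->
    nablaJ nabla J x v (fun y => f y *: B y) = f x *: nablaJ nabla J x v B.
  move=> sf vB; rewrite /nablaJ; under eq_fun do rewrite -scalemxAr.
  rewrite (nZ x v _ _ tv sf (vfJ hJ vB)) (nZ x v _ _ tv sf vB).
  by rewrite mulmxDr -!scalemxAr scalerBr opprD addrACA subrr addr0.
have J0 : nablaJ nabla J x v (fun=> 0) = 0.
  have := JZ (fun=> 0) (fun=> 0) (smooth_cst 0) vf0.
  by rewrite /= !scale0r.
have YE : Y = fun y => \sum_j (Y y j 0 *: E j y).
  apply: funext => y; apply/matrixP => i k; rewrite ord1 summxE.
  have T : dot (val y) (Y y) = 0 by exact: vY.1.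
  under eq_bigr do rewrite !mxE mulrBr.
  rewrite sumrB (bigD1 i) //= !eqxx mulr1 big1 ?addr0; last first.
    by move=> j ji; rewrite eq_sym (negPf ji) mulr0.
  rewrite [X in _ - X](_ : _ = 0) ?subr0 //.
  transitivity (dot (val y) (Y y) * val y i 0); last by rewrite T mul0r.
  rewrite /dot mulr_suml; apply: eq_bigr => j _.
  rewrite mulrA; congr (_ * _); rewrite mulrC; congr (_ * _).
  rewrite (bigD1 j) //= !mxE !eqxx mulr1 big1 ?addr0 // => l lj.
  by rewrite !mxE (negPf lj) mulr0.
rewrite [in RHS]YE.
have -> : nablaJ nabla J x v (fun y => \sum_j (Y y j 0 *: E j y)) =
    \sum_j Y x j 0 *: nablaJ nabla J x v (E j).
  elim: (index_enum _) => [|j r IH].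
    by rewrite big_nil; under eq_fun do rewrite big_nil.
  have vj l : vector_field (fun y => Y y l 0 *: E l y) by apply: vfZ => //; exact: vY.2.
  rewrite big_cons -IH -(JZ (fun y => Y y j 0)) //; last exact: vY.2.
  under eq_fun do rewrite big_cons.
  by rewrite (JD _ _ (vj j) (vf_sum r vj)).
apply/matrixP => i k; rewrite ord1 summxE mxE; apply: eq_bigr => j _.
by rewrite !mxE mulrC.
Qed.
End Smooth.

(* Main.v *)
Require Import Defs.
From mathcomp Require Import all_boot all_order all_algebra.
From mathcomp Require Import all_classical all_reals all_analysis.
From mathcomp Require Import complex.
From mathcomp Require Import ring.
Import Order.TTheory GRing.Theory Num.Theory.
Import numFieldNormedType.Exports.
Local Open Scope ring_scope.

Set Implicit Arguments.
Unset Strict Implicit.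
Unset Printing Implicit Defensive.

(** Everything is computed with matrices on the ambient space, where [s] is the
    point [x] seen as a unit column, [J s = 0], [s^T J = 0] and
    [J^2 = s s^T - 1].

    On [T10], [T01] and the normal line the matrix [(1 + s s^T + i J) / 2] is
    0, 1 and 1, so it is the canonical map ([canonical_mapE]); unlike its
    definition through subspaces, this formula can be differentiated.

    The Levi-Civita connection of the sphere is the tangential part of the
    ambient derivative ([levi_civitaE]), so [K_v := nabla_v J] is the
    compression to the tangent space of the entrywise derivative of [J]
    ([nablaJ_mxE]).  The remaining blocks of that derivative are forced by
    differentiating [J s = 0] and [s^T J = 0] ([derivative_split]), which gives
    ([sdiff_canonical_map])

      dP(v) = u_v s^T + s u'_v + (i/2) K_v,
      u_v = (1 - i J) v / 2,   u'_v = v^T (1 - i J) / 2.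

    In [Tr (P dP(X) dP(Y))] almost all cross terms vanish, because [K_v] kills
    [s] on both sides and [P u_v = 0].  What is left is
    [u'_X u_Y - (1/4) Tr (P K_X K_Y)] ([mxtrace_split]).  After
    antisymmetrization the first term contributes
    [(-i/2) (X^T J Y - Y^T J X)], which yields the metric terms of the theorem.
    In the second one, [P] acts on the tangent space as the projection onto [T01]
    along [T10], and the commutator of [K_X] and [K_Y] preserves [T01] since each
    [K_v] anticommutes with [J] ([anticommute_derivative]); hence that trace is
    the trace on [T01] ([trace_on_T01]).  Multiplying by [1/(2i)] and taking real parts turns it
    into the imaginary part in the theorem. *)

(** * Differentiating along the radial retraction *)

Section SphereCalculus.
Local Open Scope classical_set_scope.
Context {R : realType} {n : nat}.
Local Notation V := ('cV[R]_n.+1).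
Local Notation S := (sphere R n).
Implicit Types (x : S) (v : V) (f g : S -> R).

Lemma dotxx x : dot (val x) (val x) = 1.
Proof. exact: (eqP (valP x)). Qed.

Lemma is_derive_coord (y v : V) i : is_derive y v (fun z : V => z i 0) (v i 0).
Proof.
have D : derivable id y v by exact: derivable_id.
apply: DeriveDef; first exact: (derivable_mxP _ _ _).1.
by have := derive_mx D; rewrite derive_id => /matrixP/(_ i 0) ->; rewrite mxE.
Qed.

Lemma normsqE : (fun y : V => dot y y) =
  \sum_(i < n.+1) ((fun z : V => z i 0) * (fun z => z i 0)).
Proof. by apply: funext => y; rewrite /dot fct_sumE. Qed.

Lemma differentiable_normsq (y : V) : differentiable (fun y : V => dot y y) y.
Proof.
rewrite normsqE; apply: differentiable_sum => i.
by apply: differentiableM; exact: differentiable_coord.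
Qed.

Lemma derive_normsq (y v : V) : 'D_v (fun y : V => dot y y) y = dot y v *+ 2.
Proof.
have D i := is_derive_coord y v i.
rewrite normsqE derive_val /dot -sumrMnl; apply: eq_bigr => i _.
by rewrite -mulr2n.
Qed.

Lemma differentiable_invsqrt (a : R) : 0 < a ->
  differentiable (fun a : R => (Num.sqrt a)^-1) a.
Proof.
move=> a0; apply: differentiableV; last by rewrite gt_eqF // sqrtr_gt0.
by apply/derivable1_diffP; have [] := is_derive1_sqrt a0.
Qed.

Definition inv_norm (y : V) : R := (Num.sqrt (dot y y))^-1.

Lemma differentiable_inv_norm x : differentiable inv_norm (val x).
Proof.
apply: (@differentiable_comp _ _ _ _ (fun y : V => dot y y) (fun a : R => (Num.sqrt a)^-1)).
  exact: differentiable_normsq.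
by rewrite dotxx; exact: differentiable_invsqrt.
Qed.

(** To first order a tangent displacement does not change the norm, so the
    retraction moves the point with the same velocity. *)
Lemma derive_inv_norm x v : tangent x v -> 'D_v inv_norm (val x) = 0.
Proof.
move=> tv; have D := differentiable_normsq (val x).
have D1 : differentiable (fun a : R => (Num.sqrt a)^-1) (dot (val x) (val x)).
  by rewrite dotxx; exact: differentiable_invsqrt.
rewrite deriveE; last exact: differentiable_inv_norm.
rewrite (diff_comp D D1) /= -(deriveE v D) derive_normsq tv mul0rn.
exact: linear0.
Qed.

Lemma near_normsq_gt0 x : \forall y \near val x, 0 < dot y y.
Proof.
have := differentiable_continuous (differentiable_normsq (val x)).
by move=> /cvgr_gt; apply; rewrite dotxx.
Qed.

Lemma val_retract x (y : V) : 0 < dot y y -> val (retract x y) = inv_norm y *: y.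
Proof.
move=> y0; rewrite /retract insubdK //; rewrite -topredE /=.
rewrite (_ : dot _ _ = inv_norm y ^+ 2 * dot y y) /inv_norm; last first.
  by rewrite /dot mulr_sumr; apply: eq_bigr => i _; rewrite !mxE mulrACA -expr2.
by rewrite exprVn sqr_sqrtr ?ltW // mulVf // gt_eqF.
Qed.

Lemma retractE x : retract x (val x) = x.
Proof.
by apply: val_inj; rewrite val_retract ?dotxx // /inv_norm dotxx sqrtr1 invr1 scale1r.
Qed.

(** Split along the standard basis to reduce to scalar factors. *)
Lemma differentiable_radial x :
  differentiable (fun y : V => inv_norm y *: y) (val x).
Proof.
have -> : (fun y : V => inv_norm y *: y) =
    \sum_(i < n.+1) (fun y => (inv_norm y * y i 0) *: delta_mx i 0).
  apply: funext => y; rewrite fct_sumE; apply/matrixP => j k; rewrite ord1 summxE mxE.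
  rewrite (bigD1 j) //= !mxE !eqxx mulr1 big1 ?addr0 // => i ij.
  by rewrite !mxE eq_sym (negPf ij) mulr0.
apply: differentiable_sum => i; apply: differentiableZl.
by apply: differentiableM; [exact: differentiable_inv_norm|exact: differentiable_coord].
Qed.

(** Near [x] the composite is the local extension of [f] precomposed with the
    radial retraction, and both are differentiable.  This is what licenses the
    rules of calculus for [sdiff] below. *)
Lemma smooth_derivable f x v : smooth f -> derivable (f \o retract x) (val x) v.
Proof.
move=> /(_ x) [U [g [oU Ux Cg fg]]].
have N1 : inv_norm (val x) *: val x = val x.
  by rewrite -(val_retract x) ?retractE ?dotxx.
have E : {near val x, g \o (fun y => inv_norm y *: y) =1 f \o retract x}.
  have H : \forall y \near val x, U (inv_norm y *: y).
    apply: (differentiable_continuous (differentiable_radial x)).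
    by rewrite /= N1; exact: open_nbhs_nbhs.
  near=> y; have y0 : 0 < dot y y by near: y; exact: near_normsq_gt0.
  by rewrite /= fg val_retract //; near: y.
apply: (near_eq_derivable E); apply: diff_derivable.
apply: differentiable_comp; first exact: differentiable_radial.
by rewrite N1; have [/(_ _ Ux)] := Cg 1%N.
Unshelve. all: by end_near. Qed.

Lemma sdiff_coord x v i : tangent x v -> sdiff (fun y : S => val y i 0) x v = v i 0.
Proof.
move=> tv; rewrite /sdiff.
have E : {near val x, inv_norm * (fun z : V => z i 0) =1
    (fun y : S => val y i 0) \o retract x}.
  near=> y; rewrite /= val_retract ?mxE //; near: y; exact: near_normsq_gt0.
rewrite -(near_eq_derive _ E).
have D := is_derive_coord (val x) v i.
rewrite deriveM //; last by apply: diff_derivable; exact: differentiable_inv_norm.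
rewrite derive_val derive_inv_norm // scaler0 addr0 /inv_norm dotxx sqrtr1 invr1.
by rewrite scale1r.
Unshelve. all: by end_near. Qed.

Lemma sdiff_cst (c : R) x v : sdiff (fun=> c) x v = 0.
Proof. exact: derive_cst. Qed.

Lemma sdiffD f g x v : smooth f -> smooth g ->
  sdiff (fun y => f y + g y) x v = sdiff f x v + sdiff g x v.
Proof. by move=> sf sg; apply: deriveD; exact: smooth_derivable. Qed.

Lemma sdiffM f g x v : smooth f -> smooth g ->
  sdiff (fun y => f y * g y) x v = sdiff f x v * g x + f x * sdiff g x v.
Proof.
move=> sf sg.
have := deriveM (smooth_derivable (x:=x) (v:=v) sf) (smooth_derivable (x:=x) (v:=v) sg).
by rewrite /= retractE => H; rewrite [RHS]addrC [X in _ + X]mulrC; exact: H.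
Qed.

Lemma sdiff_sum I (r : seq I) (F : I -> S -> R) x v : (forall i, smooth (F i)) ->
  sdiff (fun y => \sum_(i <- r) F i y) x v = \sum_(i <- r) sdiff (F i) x v.
Proof.
move=> sF; elim: r => [|i r IH].
  by under eq_fun do rewrite big_nil; rewrite big_nil sdiff_cst.
under eq_fun do rewrite big_cons; rewrite sdiffD ?IH ?big_cons //.
exact: smooth_sum.
Qed.

End SphereCalculus.

(** * The Levi-Civita connection of the sphere *)

Section LeviCivita.
Context {R : realType} {n : nat}.
Local Notation V := ('cV[R]_n.+1).
Local Notation S := (sphere R n).
Implicit Types (x : S) (v w : V).

Definition smooth_mx p q (F : S -> 'M[R]_(p, q)) : Prop :=
  forall i j, smooth (fun y => F y i j).

(** The canonical map is assembled from two real matrices, so its derivative is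
    reached through real ones; see [sdiff_mx_toC]. *)
Definition sdiffR p q (F : S -> 'M[R]_(p, q)) x v : 'M[R]_(p, q) :=
  \matrix_(i, j) sdiff (fun y => F y i j) x v.

Lemma smooth_mx_cst p q (A : 'M[R]_(p, q)) : smooth_mx (fun=> A).
Proof. by move=> i j; exact: smooth_cst. Qed.

Lemma smooth_mx_val : smooth_mx (fun x => val x).
Proof. by move=> i j; rewrite ord1; exact: smooth_coord. Qed.

Lemma smooth_mx_tr p q (F : S -> 'M[R]_(p, q)) :
  smooth_mx F -> smooth_mx (fun y => (F y)^T).
Proof. by move=> sF i j; under eq_fun do rewrite mxE; exact: sF. Qed.

Lemma smooth_mxM p q r (F : S -> 'M[R]_(p, q)) (G : S -> 'M[R]_(q, r)) :
  smooth_mx F -> smooth_mx G -> smooth_mx (fun y => F y *m G y).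
Proof.
move=> sF sG i j; under eq_fun do rewrite mxE.
by apply: smooth_sum => k; exact: smoothM.
Qed.

Lemma smooth_mx_vf Y : vector_field Y -> smooth_mx Y.
Proof. by move=> [_ sY] i j; rewrite ord1; exact: sY. Qed.

Lemma sdiffR_cst p q (A : 'M[R]_(p, q)) x v : sdiffR (fun=> A) x v = 0.
Proof. by apply/matrixP => i j; rewrite !mxE sdiff_cst. Qed.

Lemma sdiffR_val x v : tangent x v -> sdiffR (fun x => val x) x v = v.
Proof. by move=> tv; apply/matrixP => i j; rewrite mxE ord1 sdiff_coord. Qed.

Lemma sdiffR_tr p q (F : S -> 'M[R]_(p, q)) x v :
  sdiffR (fun y => (F y)^T) x v = (sdiffR F x v)^T.
Proof.
apply/matrixP => i j; rewrite mxE [RHS]mxE [RHS]mxE.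
by under eq_fun do rewrite mxE.
Qed.

Lemma sdiffRD p q (F G : S -> 'M[R]_(p, q)) x v : smooth_mx F -> smooth_mx G ->
  sdiffR (fun y => F y + G y) x v = sdiffR F x v + sdiffR G x v.
Proof.
move=> sF sG; apply/matrixP => i j; rewrite !mxE.
by under eq_fun do rewrite mxE; exact: sdiffD.
Qed.

Lemma sdiffRM p q r (F : S -> 'M[R]_(p, q)) (G : S -> 'M[R]_(q, r)) x v :
  smooth_mx F -> smooth_mx G ->
  sdiffR (fun y => F y *m G y) x v = sdiffR F x v *m G x + F x *m sdiffR G x v.
Proof.
move=> sF sG; apply/matrixP => i j; rewrite !mxE -big_split /=.
under eq_fun do rewrite mxE; rewrite sdiff_sum; last by move=> k; exact: smoothM.
by apply: eq_bigr => k _; rewrite !mxE sdiffM.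
Qed.

Lemma sdiffRZ p q (a : R) (F : S -> 'M[R]_(p, q)) x v : smooth_mx F ->
  sdiffR (fun y => a *: F y) x v = a *: sdiffR F x v.
Proof.
move=> sF; under eq_fun do rewrite -mul_scalar_mx.
by rewrite sdiffRM ?sdiffR_cst ?mul0mx ?add0r ?mul_scalar_mx //; exact: smooth_mx_cst.
Qed.

Lemma dotC v w : dot v w = dot w v.
Proof. by apply: eq_bigr => i _; rewrite mulrC. Qed.

Lemma dotBl u v w : dot (u - v) w = dot u w - dot v w.
Proof. by rewrite /dot -sumrB; apply: eq_bigr => i _; rewrite !mxE mulrBl. Qed.

Lemma sdiff_dot (Y Z : S -> V) x v : smooth_mx Y -> smooth_mx Z ->
  sdiff (fun y => dot (Y y) (Z y)) x v =
    dot (sdiffR Y x v) (Z x) + dot (Y x) (sdiffR Z x v).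
Proof.
move=> sY sZ; rewrite /dot sdiff_sum; last by move=> k; exact: smoothM.
by rewrite -big_split; apply: eq_bigr => k _; rewrite !mxE sdiffM.
Qed.

Lemma dot_eq0 v : dot v v = 0 -> v = 0.
Proof.
move=> v0; apply/matrixP => i j; rewrite ord1 mxE; apply/eqP; rewrite -sqrf_eq0 expr2.
have nn k : true -> 0 <= v k 0 * v k 0 by move=> _; rewrite -expr2 sqr_ge0.
by rewrite (psumr_eq0P nn v0).
Qed.

Definition tproj x : 'M[R]_n.+1 := 1%:M - val x *m (val x)^T.

Lemma tangent_partE w x : tangent_part w x = tproj x *m w.
Proof.
by rewrite /tproj mulmxBl mul1mx -mulmxA tr_mul_dot mul_mx_scalar.
Qed.

Lemma tangent_part_id x v : tangent x v -> tangent_part v x = v.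
Proof. by move=> tv; rewrite /tangent_part tv scale0r subr0. Qed.

Lemma tangentB x v w : tangent x v -> tangent x w -> tangent x (v - w).
Proof. by rewrite /tangent => vx wx; rewrite dotC dotBl ![dot _ (val x)]dotC vx wx subrr. Qed.

Lemma dot_tangent_part x v w : tangent x v -> dot (tangent_part w x) v = dot w v.
Proof.
move=> tv; rewrite /tangent_part dotBl [X in _ - X](_ : _ = 0) ?subr0 //.
by rewrite dotE linearZ /= -scalemxAl mxE -dotE tv mulr0.
Qed.

Section Uniqueness.
Variables (nabla : connection R n) (hnabla : levi_civita nabla).

(** Connections are only constrained on vector fields, so the tangent vector is
    first extended to one. *)
Lemma tangent_nabla x v Y : tangent x v -> vector_field Y -> tangent x (nabla x v Y).
Proof.
have [[vf _ _ _] _ _] := hnabla => tv vY.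
have [/(_ x)] := vf _ _ (vf_tangent_part v) vY.
by rewrite tangent_part_id.
Qed.

(** Test the vanishing of the torsion on the coordinate functions: their
    derivatives along a field are the components of that field, so no second
    derivative appears. *)
Lemma nabla_bracket X Y x : vector_field X -> vector_field Y ->
  nabla x (X x) Y - nabla x (Y x) X = sdiffR Y x (X x) - sdiffR X x (Y x).
Proof.
have [_ _ tf] := hnabla => vX vY.
have [tX _] := vX; have [tY _] := vY.
have sdcoord (Z : S -> V) i w : vector_field Z ->
    sdiff (fun y => sdiff (fun z : S => val z i 0) y (Z y)) x w =
    sdiff (fun y => Z y i 0) x w.
  move=> [tZ _]; apply: (congr1 (fun g : S -> R => sdiff g x w)).
  by apply: funext => y; exact: (sdiff_coord i (tZ y)).
have tB : tangent x (nabla x (X x) Y - nabla x (Y x) X).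
  by apply: tangentB; exact: tangent_nabla.
apply/matrixP => i j; rewrite ord1 -(sdiff_coord i tB).
apply: (etrans (tf X Y _ x vX vY (smooth_coord i))).
apply: (etrans (congr2 (fun a b => a - b) (sdcoord Y i _ vY) (sdcoord X i _ vX))).
by rewrite [RHS]mxE [X in _ = X + _]mxE [X in _ = _ + X]mxE [X in _ = _ - X]mxE.
Qed.

Let gap x v Y : V := nabla x v Y - tangent_part (sdiffR Y x v) x.

Let gap_sym X Y x : vector_field X -> vector_field Y ->
  gap x (X x) Y = gap x (Y x) X.
Proof.
move=> vX vY; have [tX _] := vX; have [tY _] := vY.
have E := nabla_bracket x vX vY.
have T : tangent_part (sdiffR Y x (X x) - sdiffR X x (Y x)) x =
    nabla x (X x) Y - nabla x (Y x) X.
  by rewrite -E tangent_part_id //; apply: tangentB; exact: tangent_nabla.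
move: T; rewrite /gap tangent_partE mulmxBr -!tangent_partE => T.
apply/eqP; rewrite subr_eq -addrA [- _ + _]addrC T.
by rewrite addrC subrK.
Qed.

Let dot_gap x v Y w : tangent x w ->
  dot (gap x v Y) w = dot (nabla x v Y) w - dot (sdiffR Y x v) w.
Proof.
by move=> tw; rewrite -(dot_tangent_part (sdiffR Y x v) tw); exact: dotBl.
Qed.

Let gap_skew x v Y Z : tangent x v -> vector_field Y -> vector_field Z ->
  dot (gap x v Y) (Z x) = - dot (gap x v Z) (Y x).
Proof.
have [_ mc _] := hnabla => tv vY vZ; have [tY _] := vY; have [tZ _] := vZ.
apply: (etrans (dot_gap v Y (tZ x))).
apply: (etrans _ (congr1 -%R (esym (dot_gap v Z (tY x))))).
have := etrans (esym (mc x v Y Z tv vY vZ))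
  (sdiff_dot x v (smooth_mx_vf vY) (smooth_mx_vf vZ)).
rewrite ![dot (Y x) _]dotC => E; apply/eqP.
by rewrite -subr_eq0 opprK addrACA E -opprD subrr.
Qed.

Let gap_eq0 X Y Z x : vector_field X -> vector_field Y -> vector_field Z ->
  dot (gap x (X x) Y) (Z x) = 0.
Proof.
move=> vX vY vZ; have [tX _] := vX; have [tY _] := vY; have [tZ _] := vZ.
have sym A B (vA : vector_field A) (vB : vector_field B) (c : V) :=
  congr1 (fun w => dot w c) (gap_sym x vA vB).
(* Alternate skewness and symmetry along X Y Z, X Z Y, Z X Y, Z Y X, Y Z X,
   Y X Z, X Y Z: three sign changes. *)
have t0 := etrans (gap_skew (tX x) vY vZ) (congr1 -%R (sym _ _ vX vZ (Y x))).
have t1 := etrans (gap_skew (tZ x) vX vY) (congr1 -%R (sym _ _ vZ vY (X x))).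
have t2 := etrans (gap_skew (tY x) vZ vX) (congr1 -%R (sym _ _ vY vX (Z x))).
have := etrans t0 (congr1 -%R (etrans t1 (congr1 -%R t2))).
by move=> /eqP; rewrite opprK -addr_eq0 -mulr2n mulrn_eq0 /= => /eqP.
Qed.

(** The difference [gap] between [nabla] and the tangential derivative is
    symmetric in its two fields because both are torsion free, and skew for the
    metric because both are metric.  A trilinear form that is symmetric in its
    first two slots and skew in its last two is zero. *)
Lemma levi_civitaE x v Y : tangent x v -> vector_field Y ->
  nabla x v Y = tangent_part (sdiffR Y x v) x.
Proof.
move=> tv vY; apply/eqP; rewrite -subr_eq0; apply/eqP; apply: dot_eq0.
set w := nabla x v Y - _.
have tw : tangent x w.
  apply: tangentB; first exact: tangent_nabla.
  by case: (vf_tangent_part (sdiffR Y x v)).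
have := gap_eq0 x (vf_tangent_part v) vY (vf_tangent_part w).
by rewrite (tangent_part_id tv) (tangent_part_id tw).
Qed.

End Uniqueness.
End LeviCivita.

(** * The derivative of an almost complex structure *)

Section DerivativeOfJ.
Context {R : realType} {n : nat}.
Local Notation V := ('cV[R]_n.+1).
Local Notation S := (sphere R n).
Variables (J : S -> 'M[R]_n.+1) (hJ : almost_complex J).
Implicit Types (x : S) (v : V).

Lemma trmx_mul_val x : (val x)^T *m val x = 1%:M.
Proof. by rewrite tr_mul_dot dotxx. Qed.

Lemma tproj_val x : tproj x *m val x = 0.
Proof. by rewrite /tproj mulmxBl mul1mx -mulmxA trmx_mul_val mulmx1 subrr. Qed.

Lemma val_tproj x : (val x)^T *m tproj x = 0.
Proof. by rewrite /tproj mulmxBr mulmx1 mulmxA trmx_mul_val mul1mx subrr. Qed.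

Lemma J_val x : J x *m val x = 0.
Proof. by case: hJ. Qed.

(** [J] commutes with [1 + J^2 = s s^T], so [s s^T J = J s s^T = 0]. *)
Lemma val_J x : (val x)^T *m J x = 0.
Proof.
have E : val x *m (val x)^T *m J x = 0.
  rewrite -(sqr_almost_complex x hJ) mulmxDl mul1mx -mulmxA.
  rewrite -[X in X + _]mulmx1 -mulmxDr (sqr_almost_complex x hJ).
  by rewrite mulmxA J_val mul0mx.
by rewrite -[(val x)^T]mul1mx -(trmx_mul_val x) -!mulmxA [_ *m (_ *m J x)]mulmxA E mulmx0.
Qed.

Lemma J_tproj x : J x *m tproj x = J x.
Proof. by rewrite /tproj mulmxBr mulmx1 mulmxA J_val mul0mx subr0. Qed.

Lemma tproj_J x : tproj x *m J x = J x.
Proof. by rewrite /tproj mulmxBl mul1mx -mulmxA val_J mulmx0 subr0. Qed.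

Lemma smooth_mx_J : smooth_mx J.
Proof. by case: hJ. Qed.

(** The Leibniz rule for [J E_j], with [E_j] the projected basis fields: the
    terms where [E_j] is differentiated cancel, as [J] absorbs the projection. *)
Lemma nablaJ_mxE nabla x v : levi_civita nabla -> tangent x v ->
  nablaJ_mx nabla J x v = tproj x *m sdiffR J x v *m tproj x.
Proof.
move=> hnabla tv; apply/matrixP => i j; rewrite mxE /nablaJ.
have vE := vf_tangent_part (delta_mx j 0 : V).
have vJE := vfJ hJ vE.
rewrite !(levi_civitaE hnabla) // !tangent_partE (sdiffRM x v smooth_mx_J (smooth_mx_vf vE)).
rewrite mulmxDr !mulmxA tproj_J J_tproj addrK tangent_partE mulmxA -colE.
by rewrite mxE.
Qed.

(** Differentiate [1 + J^2 = s s^T]; the right-hand side contributes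
    [v s^T + s v^T], which the projections on both sides remove. *)
Lemma anticommute_derivative x v : tangent x v ->
  (tproj x *m sdiffR J x v *m tproj x) *m J x +
  J x *m (tproj x *m sdiffR J x v *m tproj x) = 0.
Proof.
move=> tv; have sJ := smooth_mx_J.
have E : sdiffR J x v *m J x + J x *m sdiffR J x v =
    v *m (val x)^T + val x *m v^T.
  rewrite -sdiffRM // -[LHS]add0r -(sdiffR_cst 1%:M x v) -sdiffRD; last 2 first.
  - exact: smooth_mx_cst.
  - exact: smooth_mxM.
  under eq_fun do rewrite sqr_almost_complex //.
  have sV := @smooth_mx_val R n.
  by rewrite (sdiffRM x v sV (smooth_mx_tr sV)) sdiffR_tr sdiffR_val.
rewrite -mulmxA tproj_J !mulmxA J_tproj.
have : tproj x *m (sdiffR J x v *m J x + J x *m sdiffR J x v) *m tproj x = 0.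
  rewrite E mulmxDr mulmxDl !mulmxA tproj_val !mul0mx addr0.
  by rewrite -mulmxA val_tproj mulmx0.
by rewrite mulmxDr mulmxDl !mulmxA tproj_J -[X in X + _ = 0 -> _]mulmxA J_tproj.
Qed.

(** The blocks of the derivative that involve the normal line come from
    differentiating [J s = 0] and [s^T J = 0]; its normal-normal block
    [- s^T J v] vanishes. *)
Lemma derivative_split x v : tangent x v ->
  sdiffR J x v = tproj x *m sdiffR J x v *m tproj x
    - val x *m (v^T *m J x) - (J x *m v) *m (val x)^T.
Proof.
move=> tv; have sJ := smooth_mx_J; have sV := @smooth_mx_val R n.
have Ds : sdiffR J x v *m val x = - (J x *m v).
  apply/eqP; rewrite -addr_eq0 -{2}(sdiffR_val tv) -sdiffRM //.
  by under eq_fun do rewrite J_val; rewrite sdiffR_cst.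
have sD : (val x)^T *m sdiffR J x v = - (v^T *m J x).
  apply/eqP; rewrite -addr_eq0 -{2}(sdiffR_val tv) -sdiffR_tr addrC.
  rewrite -(sdiffRM x v (smooth_mx_tr sV) sJ).
  by under eq_fun do rewrite val_J; rewrite sdiffR_cst.
rewrite {2}/tproj mulmxBr mulmx1 [tproj x *m _ *m (_ *m _)]mulmxA -(mulmxA (tproj x)).
rewrite Ds mulmxN [tproj x *m (J x *m v)]mulmxA tproj_J mulNmx opprK.
rewrite addrAC addrK /tproj mulmxBl mul1mx -mulmxA sD.
by rewrite mulmxN opprK addrK.
Qed.

End DerivativeOfJ.

(** * The canonical map and its derivative *)

Section CanonicalMap.
Context {R : realType} {n : nat}.
Local Notation V := ('cV[R]_n.+1).
Local Notation S := (sphere R n).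
Local Notation i := ('i%C : R[i]).
Variables (J : S -> 'M[R]_n.+1) (hJ : almost_complex J).
Implicit Types (x : S) (v : V).

(** The projection onto [T01] along [T10] and the normal line: on the tangent
    space it is [(1 + i J) / 2]. *)
Definition T01_proj x : 'M[R[i]]_n.+1 :=
  toC (2%:R^-1 *: tproj x) + i *: toC (2%:R^-1 *: J x).

Lemma toC_halve p q (A : 'M[R]_(p, q)) : toC (2%:R^-1 *: A) = 2%:R^-1 *: toC A.
Proof. by rewrite /toC map_mxZ fmorphV rmorph_nat. Qed.

Lemma T01_projE x : (T01_proj x)^T =
  2%:R^-1 *: (i *: (toC (J x))^T - (toC (J x))^T *m (toC (J x))^T).
Proof.
rewrite /T01_proj; have -> : tproj x = - (J x *m J x).
  by rewrite /tproj -(sqr_almost_complex x hJ) opprD addNKr.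
rewrite !toC_halve scalerA mulrC -scalerA -scalerDr.
rewrite (_ : toC (- (J x *m J x)) = - (toC (J x) *m toC (J x))); last first.
  by rewrite /toC map_mxN map_mxM.
rewrite -trmx_mul addrC; apply/matrixP => k l.
by rewrite !mxE.
Qed.

Lemma J_cube x : let A := (toC (J x))^T in A *m A *m A = - A.
Proof.
move=> A; have H : toC (J x *m (J x *m J x)) = - toC (J x).
  have -> : J x *m J x = val x *m (val x)^T - 1%:M.
    by rewrite -(sqr_almost_complex x hJ) addrAC subrr add0r.
  by rewrite mulmxBr mulmx1 mulmxA J_val // mul0mx sub0r /toC map_mxN.
rewrite /A -!trmx_mul (_ : toC _ *m _ = toC (J x *m (J x *m J x))).
  by rewrite H linearN.
by rewrite /toC !map_mxM.
Qed.

Lemma T01_proj_sub x : ((T01_proj x)^T <= T01 J x)%MS.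
Proof.
apply/eigenspaceP; rewrite T01_projE; set A := (toC _)^T.
rewrite -scalemxAl mulmxBl -scalemxAl J_cube opprK.
rewrite scalerA mulrC -scalerA scalerBr scalerA mulNr i2 opprK scale1r scaleNr opprK.
by rewrite addrC.
Qed.

Lemma T01_proj_id x : T01 J x *m (T01_proj x)^T = T01 J x.
Proof.
have E : T01 J x *m (toC (J x))^T = - i *: T01 J x by apply/eigenspaceP.
rewrite T01_projE -scalemxAr mulmxBr -scalemxAr mulmxA E -scalemxAl E.
rewrite !scalerA mulrN i2 mulrNN i2 !opprK scale1r scaleN1r opprK.
by rewrite -mulr2n -[T01 J x *+ 2]scaler_nat scalerA mulVf ?scale1r // pnatr_eq0.
Qed.

(** The transposed right-hand side has rows in the sum of [T01] and the normal
    line, and its complement [B] has rows in [T10]; as these spaces are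
    independent, this determines the projection. *)
Lemma canonical_mapE x : canonical_map J x =
  toC (2%:R^-1 *: (1%:M + val x *m (val x)^T)) + i *: toC (2%:R^-1 *: J x).
Proof.
set s := val x; set A := (toC (J x))^T.
pose N := toC s *m (toC s)^T.
pose B := 2%:R^-1 *: (- i *: A - A *m A).
have hh : 2%:R^-1 + 2%:R^-1 = 1 :> R[i].
  by rewrite -mulr2n -[2%:R^-1]mulr1 -mulrnAr mulVf ?pnatr_eq0.
have BE : 1%:M = ((T01_proj x)^T + N) + B.
  rewrite T01_projE /N -(sqr_toC x hJ) addrAC -scalerDr addrACA scaleNr subrr add0r.
  rewrite -mulr2n -[(- _) *+ 2]scaler_nat scalerA mulVf ?pnatr_eq0 // scale1r.
  by rewrite addrC addrK.
have sB : (B <= T10 J x)%MS.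
  apply/eigenspaceP; rewrite /B -scalemxAl mulmxBl -scalemxAl J_cube opprK.
  rewrite scalerA [X in _ = X *: _]mulrC -scalerA scalerBr scalerA mulrN i2 opprK scale1r scaleNr.
  by rewrite addrC.
have sN : (N <= normal_lineC x)%MS by rewrite /normal_lineC genmxE; exact: submxMl.
have D := canonical_disjoint x hJ.
rewrite /canonical_map -[proj_mx _ _]mul1mx BE mulmxDl (proj_mx_0 D sB) addr0.
have sTN : (((T01_proj x)^T + N)%R <= T01 J x + normal_lineC x)%MS.
  by apply: addmx_sub_adds; [exact: T01_proj_sub|].
rewrite (proj_mx_id D sTN).
rewrite linearD /= trmxK /N trmx_mul trmxK addrAC /T01_proj; congr (_ + _).
have -> : toC s *m (toC s)^T = toC (s *m s^T) by rewrite /toC map_mxM map_trmx.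
rewrite !toC_halve /tproj -/s /toC map_mxB map_mxD map_mx1.
rewrite scalerBr scalerDr -addrA; congr (_ + _).
by apply/eqP; rewrite addrC subr_eq -scalerDl hh scale1r.
Qed.

Lemma sdiff_mx_toC p q (F : S -> 'M[R[i]]_(p, q)) (A B : S -> 'M[R]_(p, q)) x v :
  (forall y, F y = toC (A y) + i *: toC (B y)) ->
  sdiff_mx F x v = toC (sdiffR A x v) + i *: toC (sdiffR B x v).
Proof.
move=> E; apply/matrixP => k l; rewrite !mxE.
have e y : F y k l = Complex (A y k l) (B y k l).
  rewrite E !mxE; apply/eqP; rewrite eq_complex /=.
  by rewrite !(mul0r, mul1r, mulr0, subr0, addr0, add0r) !eqxx.
have -> : (fun y => complex.Re (F y k l)) = (fun y => A y k l).
  by apply: funext => y; rewrite e.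
have -> : (fun y => complex.Im (F y k l)) = (fun y => B y k l).
  by apply: funext => y; rewrite e.
by apply/eqP; rewrite eq_complex /= !(mul0r, mul1r, mulr0, subr0, addr0, add0r) !eqxx.
Qed.

End CanonicalMap.

(** * Two trace computations *)

(** If [Q] is a projection onto the invariant subspace [W], the trace of the
    restriction of [f] to [W] is that of [Q f]: in a basis adapted to [W], the
    product has the same diagonal blocks as the restriction and zero. *)
Lemma trace_restrictmx (F : fieldType) N (W Q f : 'M[F]_N) :
  (Q <= W)%MS -> W *m Q = W -> stablemx W f ->
  \tr (conjmx (row_base W) f) = \tr (Q *m f).
Proof.
move=> QW WQ Wf; set B := row_base W.
have sBf : (B *m f <= B)%MS by rewrite stablemx_row_base.
have /submxP [D QD] : (Q <= B)%MS by rewrite eq_row_base.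
have BQ : B *m Q = B.
  have /submxP [E ->] : (B <= W)%MS by rewrite eq_row_base.
  by rewrite -mulmxA WQ.
have BD : B *m D = 1%:M.
  by apply: (row_free_inj (row_base_free W)); rewrite -mulmxA -QD BQ mul1mx.
(* Both traces are those of the small matrix of f in the basis B. *)
rewrite QD -mulmxA -[in RHS](mulmxKpV sBf) -/(conjmx B f) [RHS]mxtrace_mulC.
by rewrite -mulmxA BD mulmx1.
Qed.

(** The block computation behind the theorem: [k] and [l] live on the complement
    of the line of [s], while [u r + s u'] exchanges that line with its
    complement.  Only two products close up to a nonzero trace. *)
Lemma mxtrace_split (F : comNzRingType) N (P k l : 'M[F]_N)
    (s u w : 'cV[F]_N) (r u' w' : 'rV[F]_N) :
  r *m s = 1%:M -> r *m w = 0 -> u' *m s = 0 ->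
  r *m k = 0 -> k *m s = 0 -> l *m s = 0 ->
  P *m s = s -> r *m P = r -> P *m u = 0 ->
  \tr (P *m (u *m r + s *m u' + k) *m (w *m r + s *m w' + l)) =
    \tr (u' *m w) + \tr (P *m k *m l).
Proof.
move=> rs rw us rk ks ls Ps rP Pu.
rewrite !mulmxDr !mulmxA Pu mul0mx add0r Ps !mulmxDl !linearD /=.
have -> : \tr (s *m u' *m w *m r) = \tr (u' *m w).
  by rewrite mxtrace_mulC !mulmxA rs mul1mx.
have -> : \tr (P *m k *m w *m r) = 0.
  by rewrite mxtrace_mulC !mulmxA rP rk !mul0mx mxtrace0.
have -> : \tr (s *m u' *m l) = 0.
  by rewrite -mulmxA mxtrace_mulC -mulmxA ls mulmx0 mxtrace0.
rewrite -(mulmxA s u' s) us mulmx0 mul0mx.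
by rewrite -(mulmxA P k s) ks mulmx0 mul0mx mxtrace0 !(addr0, add0r).
Qed.

(** * The pullback of the 2-form *)

Section Pullback.
Context {R : realType} {n : nat}.
Local Notation V := ('cV[R]_n.+1).
Local Notation S := (sphere R n).
Local Notation i := ('i%C : R[i]).
Variables (J : S -> 'M[R]_n.+1) (hJ : almost_complex J).
Implicit Types (x : S) (v w X Y : V).

Lemma toCB p q (A B : 'M[R]_(p, q)) : toC (A - B) = toC A - toC B.
Proof. exact: map_mxB. Qed.

Lemma toCD p q (A B : 'M[R]_(p, q)) : toC (A + B) = toC A + toC B.
Proof. exact: map_mxD. Qed.

Lemma sdiffR_normal x v : tangent x v ->
  sdiffR (fun y : S => 2%:R^-1 *: (1%:M + val y *m (val y)^T)) x v =
    2%:R^-1 *: (v *m (val x)^T + val x *m v^T).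
Proof.
move=> tv; have sV := @smooth_mx_val R n; have sVt := smooth_mx_tr sV.
have sVV := smooth_mxM sV sVt; have s1 := @smooth_mx_cst R n _ _ (1%:M : 'M[R]_n.+1).
have sF : smooth_mx (fun y : S => 1%:M + val y *m (val y)^T).
  by move=> k l; under eq_fun do rewrite mxE; apply: smoothD; [exact: s1|exact: sVV].
rewrite (sdiffRZ _ x v sF); congr (_ *: _).
have -> := sdiffRD x v s1 sVV; have -> := sdiffRM x v sV sVt.
by rewrite sdiffR_cst add0r sdiffR_tr sdiffR_val.
Qed.

Lemma toCM p q r (A : 'M[R]_(p, q)) (B : 'M[R]_(q, r)) : toC (A *m B) = toC A *m toC B.
Proof. exact: map_mxM. Qed.

(** On tangent vectors [(1 - i J) / 2] is the projection onto [T10] along [T01]. *)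
Definition T10_part x v : 'cV[R[i]]_n.+1 :=
  2%:R^-1 *: (toC v - i *: toC (J x *m v)).

(** The inner product with [v] on [T10], extended by 0 to [T01] and the normal
    line when [v] is tangent. *)
Definition T10_coform x v : 'rV[R[i]]_n.+1 :=
  2%:R^-1 *: (toC v^T - i *: toC (v^T *m J x)).

(** The derivative of a projection exchanges its image and its kernel.  The first
    two terms exchange the normal line with [T10]; as [nabla_v J] anticommutes
    with [J], the last one exchanges [T01] with [T10]. *)
Lemma sdiff_canonical_map nabla x v : levi_civita nabla -> tangent x v ->
  sdiff_mx (canonical_map J) x v =
    T10_part x v *m toC (val x)^T + toC (val x) *m T10_coform x v
    + (2%:R^-1 * i) *: toC (nablaJ_mx nabla J x v).
Proof.
move=> hnabla tv.
rewrite (sdiff_mx_toC x v (canonical_mapE hJ)); have -> := sdiffR_normal tv.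
rewrite (sdiffRZ _ x v (smooth_mx_J hJ)).
rewrite (derivative_split hJ tv) -(nablaJ_mxE hJ hnabla tv) !toC_halve.
rewrite /T10_part /T10_coform -scalemxAl mulmxBl -scalemxAl -scalemxAr mulmxBr -scalemxAr.
rewrite toCD !toCB !toCM.
move: (_ *m toC (val x)^T) (_ *m toC (val x)^T) (toC (val x) *m _).
move: (toC (val x) *m _) (toC (nablaJ_mx _ _ _ _)) => a k b c d.
apply/matrixP => p q; rewrite !mxE.
move: (a p q) (b p q) (c p q) (d p q) (k p q) ('i%C) => {}a {}b {}c {}d {}k j.
ring.
Qed.

(** [A^T] preserves the row space [T01] because it commutes with [J^T]. *)
Lemma trace_on_T01 x (A : 'M[R]_n.+1) : A *m J x = J x *m A ->
  trace_on (T01 J x) (toC A) = \tr (T01_proj J x *m toC A).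
Proof.
move=> AJ; rewrite /trace_on (trace_restrictmx (T01_proj_sub hJ x) (T01_proj_id hJ x)).
  by rewrite -trmx_mul mxtrace_tr mxtrace_mulC.
by apply: comm_mx_stable_eigenspace; rewrite /comm_mx -!trmx_mul -!toCM AJ.
Qed.

(** [(1 - i J)^2 = 2 (1 - i J)] on tangent vectors. *)
Lemma tr_T10 x v w : tangent x w ->
  \tr (T10_coform x v *m T10_part x w) =
    2%:R^-1 ^+ 2 * ((dot v w)%:C%C - i * (dot v (J x *m w))%:C%C) *+ 2.
Proof.
move=> tw; rewrite /T10_coform /T10_part -scalemxAl -scalemxAr mulmxBr !mulmxBl.
rewrite -!scalemxAl -!scalemxAr -!toCM.
have -> : v^T *m J x *m (J x *m w) = - (v^T *m w).
  by case: hJ => _ _ _ J2; rewrite -mulmxA J2 // mulmxN.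
rewrite -mulmxA; set a := toC (v^T *m w); set b := toC (v^T *m (J x *m w)).
have -> : toC (- (v^T *m w)) = - a by rewrite /a /toC map_mxN.
have [-> ->] : a = (dot v w)%:C%C%:M /\ b = (dot v (J x *m w))%:C%C%:M.
  by rewrite /a /b !tr_mul_dot /toC !map_scalar_mx.
rewrite !trace_mx11 !mxE /= !mulr1n.
have := @i2 R; move: (_%:C)%C (_%:C)%C ('i%C) => {}b {}a j j2.
(* Collect the square of the imaginary unit before using its value. *)
transitivity (2^-1 * (2^-1 * (a - (j * j) * a - j * b *+ 2))); first by ring.
by rewrite j2; ring.
Qed.

Lemma canonical_map_split x :
  canonical_map J x = T01_proj J x + toC (val x) *m toC (val x)^T.
Proof.
rewrite canonical_mapE // /T01_proj addrAC -toCM -toCD; congr (toC _ + _).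
by rewrite /tproj; move: (val x *m _) => A; apply/matrixP => k l; rewrite !mxE; field.
Qed.

Lemma toC_val1 x : toC (val x)^T *m toC (val x) = 1%:M.
Proof. by rewrite -toCM trmx_mul_val /toC map_mx1. Qed.

Lemma toC_eq0 p q r (A : 'M[R]_(p, q)) (B : 'M[R]_(q, r)) :
  A *m B = 0 -> toC A *m toC B = 0.
Proof. by move=> AB; rewrite -toCM AB /toC map_mx0. Qed.

Lemma T01_proj_val x : T01_proj J x *m toC (val x) = 0.
Proof.
rewrite /T01_proj mulmxDl -scalemxAl !toC_eq0 ?scaler0 ?addr0 //.
  by rewrite -scalemxAl J_val // scaler0.
by rewrite -scalemxAl tproj_val scaler0.
Qed.

Lemma val_T01_proj x : toC (val x)^T *m T01_proj J x = 0.
Proof.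
rewrite /T01_proj mulmxDr -scalemxAr !toC_eq0 ?scaler0 ?addr0 //.
  by rewrite -scalemxAr val_J // scaler0.
by rewrite -scalemxAr val_tproj scaler0.
Qed.

Lemma canonical_map_val x : canonical_map J x *m toC (val x) = toC (val x).
Proof.
by rewrite canonical_map_split mulmxDl T01_proj_val add0r -mulmxA toC_val1 mulmx1.
Qed.

Lemma val_canonical_map x : toC (val x)^T *m canonical_map J x = toC (val x)^T.
Proof.
by rewrite canonical_map_split mulmxDr val_T01_proj add0r mulmxA toC_val1 mul1mx.
Qed.

Lemma tr_val_tangent x v : tangent x v -> (val x)^T *m v = 0.
Proof. by move=> tv; rewrite tr_mul_dot tv; apply/matrixP => k l; rewrite !mxE mul0rn. Qed.

Lemma val_T10_part x v : tangent x v -> toC (val x)^T *m T10_part x v = 0.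
Proof.
move=> tv; rewrite /T10_part -scalemxAr mulmxBr -scalemxAr.
rewrite !toC_eq0 ?scaler0 ?subr0 ?scaler0 //; last exact: tr_val_tangent.
by rewrite mulmxA val_J // mul0mx.
Qed.

Lemma T10_coform_val x v : tangent x v -> T10_coform x v *m toC (val x) = 0.
Proof.
move=> tv; rewrite /T10_coform -scalemxAl mulmxBl -scalemxAl.
rewrite !toC_eq0 ?scaler0 ?subr0 ?scaler0 //; last first.
  by apply: trmx_inj; rewrite trmx_mul trmxK tr_val_tangent // trmx0.
by rewrite -mulmxA J_val // mulmx0.
Qed.

(** [T10] is the kernel of the projection. *)
Lemma canonical_map_T10_part x v : tangent x v ->
  canonical_map J x *m T10_part x v = 0.
Proof.
move=> tv; rewrite canonical_map_split mulmxDl -mulmxA val_T10_part // mulmx0 addr0.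
rewrite /T01_proj /T10_part !toC_halve mulmxDl -!scalemxAl -!scalemxAr !mulmxBr.
rewrite -!scalemxAr -!toCM -tangent_partE tangent_part_id // mulmxA tproj_J //.
have -> : J x *m (J x *m v) = - v by case: hJ => _ _ _; apply.
have -> : toC (- v) = - toC v by rewrite /toC map_mxN.
move: (toC v) (toC (J x *m v)) => a b; apply/matrixP => k l; rewrite !mxE.
have := @i2 R; move: (a k l) (b k l) ('i%C) => {}a {}b j j2.
transitivity (2^-1 * (2^-1 * (a + (j * j) * a))); first by ring.
by rewrite j2; ring.
Qed.

Lemma mxtrace_canonical_map nabla x X Y : levi_civita nabla ->
  tangent x X -> tangent x Y ->
  \tr (canonical_map J x *m sdiff_mx (canonical_map J) x X *m
       sdiff_mx (canonical_map J) x Y) =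
    2%:R^-1 ^+ 2 * ((dot X Y)%:C%C - i * (dot X (J x *m Y))%:C%C) *+ 2
    - 2%:R^-1 ^+ 2 * \tr (T01_proj J x *m toC (nablaJ_mx nabla J x X) *m
                         toC (nablaJ_mx nabla J x Y)).
Proof.
move=> hnabla tX tY.
have Kv Z : tangent x Z -> toC (nablaJ_mx nabla J x Z) *m toC (val x) = 0.
  by move=> tZ; apply: toC_eq0; rewrite nablaJ_mxE // -mulmxA tproj_val mulmx0.
have vK Z : tangent x Z -> toC (val x)^T *m toC (nablaJ_mx nabla J x Z) = 0.
  by move=> tZ; apply: toC_eq0; rewrite nablaJ_mxE // !mulmxA val_tproj !mul0mx.
rewrite (sdiff_canonical_map hnabla tX) (sdiff_canonical_map hnabla tY).
rewrite mxtrace_split ?tr_T10 //.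
- congr (_ + _); rewrite canonical_map_split -!scalemxAr -scalemxAl !mxtraceZ.
  rewrite mulmxDl -[_ *m _ *m toC (nablaJ_mx _ _ _ X)]mulmxA vK // mulmx0 addr0.
  rewrite mulrA -mulNr; congr (_ * _).
  by rewrite mulrACA i2 mulrN1.
- exact: toC_val1.
- exact: val_T10_part.
- exact: T10_coform_val.
- by rewrite -scalemxAr vK // scaler0.
- by rewrite -scalemxAl Kv // scaler0.
- by rewrite -scalemxAl Kv // scaler0.
- exact: canonical_map_val.
- exact: val_canonical_map.
- exact: canonical_map_T10_part.
Qed.

Lemma inv_2i : (2%:R * i)^-1 = - (i * 2%:R^-1).
Proof.
have i0 : 2%:R * i != 0 by rewrite mulf_neq0 ?i_neq0 // pnatr_eq0.
apply: (mulfI i0); rewrite mulfV // mulrN.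
have -> : 2%:R * i * (i * 2%:R^-1) = i * i * (2%:R / 2%:R) by ring.
by rewrite i2 mulN1r opprK mulfV // pnatr_eq0.
Qed.

Lemma omegaE (P A B : 'M[R[i]]_n.+1) :
  omega P A B = - (i * 2%:R^-1) * (\tr (P *m A *m B) - \tr (P *m B *m A)).
Proof. by rewrite /omega inv_2i linearB. Qed.

(** The last step on scalars: the symmetric contribution [d] of the metric
    cancels between the two traces. *)
Lemma Re_scalar (t1 t2 p q : R[i]) (a b d : R) :
  t1 = 2%:R^-1 ^+ 2 * (d%:C%C - i * a%:C%C) *+ 2 - 2%:R^-1 ^+ 2 * p ->
  t2 = 2%:R^-1 ^+ 2 * (d%:C%C - i * b%:C%C) *+ 2 - 2%:R^-1 ^+ 2 * q ->
  complex.Re (- (i * 2%:R^-1) * (t1 - t2)) =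
    - (8%:R^-1 * complex.Im (p - q)) - 4%:R^-1 * a + 4%:R^-1 * b.
Proof.
move=> -> ->.
rewrite (_ : - _ * _ = (4%:R^-1 * (b - a))%:C%C + i * (8%:R^-1)%:C%C * (p - q)).
  by case: p q => [p1 p2] [q1 q2] /=; field.
have -> : (4%:R^-1 * (b - a))%:C%C = 4%:R^-1 * (b%:C%C - a%:C%C) :> R[i].
  by rewrite rmorphM rmorphB fmorphV rmorph_nat.
have -> : (8%:R^-1)%:C%C = 8%:R^-1 :> R[i] by rewrite fmorphV rmorph_nat.
have j2 := @i2 R.
move: ('i%C) (a%:C)%C (b%:C)%C (d%:C)%C j2 => j {}a {}b {}d j2.
transitivity ((j * j) * (4^-1 * (a - b)) + j * 8^-1 * (p - q)); first by field.
by rewrite j2; ring.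
Qed.

Lemma pullback_Re_omega nabla x X Y : levi_civita nabla ->
  tangent x X -> tangent x Y ->
  pullback (canonical_map J) (@Re_omega R n.+1) x X Y =
    - (8%:R^-1 * complex.Im (trace_on (T01 J x)
        (toC (nablaJ_mx nabla J x X *m nablaJ_mx nabla J x Y -
              nablaJ_mx nabla J x Y *m nablaJ_mx nabla J x X))))
    - 4%:R^-1 * dot X (J x *m Y) + 4%:R^-1 * dot Y (J x *m X).
Proof.
move=> hnabla tX tY.
set K := nablaJ_mx nabla J x.
have KJ Z : tangent x Z -> K Z *m J x = - (J x *m K Z).
  move=> tZ; apply/eqP; rewrite -addr_eq0 /K nablaJ_mxE //.
  by rewrite (anticommute_derivative hJ tZ).
have KKJ : (K X *m K Y - K Y *m K X) *m J x = J x *m (K X *m K Y - K Y *m K X).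
  by rewrite mulmxBl mulmxBr -!mulmxA !KJ // !mulmxN !mulmxA !KJ // !mulNmx !opprK.
have traceE : trace_on (T01 J x) (toC (K X *m K Y - K Y *m K X)) =
    \tr (T01_proj J x *m toC (K X) *m toC (K Y)) -
    \tr (T01_proj J x *m toC (K Y) *m toC (K X)).
  by rewrite (trace_on_T01 KKJ) toCB !toCM mulmxBr !mulmxA linearB.
rewrite traceE /pullback /Re_omega omegaE.
have trXY := mxtrace_canonical_map hnabla tX tY.
have trYX := mxtrace_canonical_map hnabla tY tX.
rewrite [dot Y X]dotC in trYX.
exact: Re_scalar trXY trYX.
Qed.

End Pullback.

Unset Implicit Arguments.

Theorem theorem4p4 (R : realType) (n : nat) (hn : n = 1%N \/ n = 3%N)
    (J : sphere R n.*2 -> 'M[R]_(n.*2.+1)) (hJ : almost_complex J)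
    (nabla : connection R n.*2) (hnabla : levi_civita nabla)
    (x : sphere R n.*2) (X Y : 'cV[R]_(n.*2.+1))
    (hX : tangent x X) (hY : tangent x Y) :
  pullback (canonical_map J) (@Re_omega R n.*2.+1) x X Y =
    - (8%:R^-1 * complex.Im (trace_on (T01 J x)
        (toC (nablaJ_mx nabla J x X *m nablaJ_mx nabla J x Y -
              nablaJ_mx nabla J x Y *m nablaJ_mx nabla J x X))))
    - 4%:R^-1 * dot X (J x *m Y) + 4%:R^-1 * dot Y (J x *m X).
Proof. exact: (pullback_Re_omega hJ hnabla hX hY). Qed.
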